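(* Let $F$ be a totally real number field with ring of integers $\mathcal O$, let $n\ge1$, let $\alpha\in F$ be totally positive, and let \[f_\alpha(x_1,\ldots,x_n)=\operatorname{Tr}_{F/\mathbb Q}\Bigl(\alpha\sum_{1\le i\le j\le n}x_ix_j\Bigr),\qquad (x_1,\dots,x_n)\in\mathcal O^n,\] and $\phi_\alpha(x)=\operatorname{Tr}_{F/\mathbb Q}(\alpha x^2)$ for $x\in\mathcal O$. Then there exist nonzero $\eta_1,\ldots,\eta_r\in\mathcal O$ such that (1) $m(f_\alpha)=m(\phi_\alpha)=\operatorname{Tr}_{F/\mathbb Q}(\alpha\eta_i^2)$ for each $i$, and (2) the set of minimal vectors of $f_\alpha$ (up to sign) is \[M(f_\alpha)=\bigcup_{1\le k\le r}\bigl(\{\eta_k e_i: 1\le i\le n\}\cup\{\eta_k(e_i-e_j): 1\le i<j\le n\}\bigr),\] where $e_1,\ldots,e_n$ is the standard basis of $\mathcal O^n$.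
   Context: An element of $F$ is totally positive if all its real embeddings are positive. For a positive-definite quadratic form $f$ on a lattice $L$ (here $\mathcal O^n$ or $\mathcal O$, viewed as $\mathbb Z$-lattices), the minimum is $m(f)=\min_{v\in L\setminus\{0\}}f(v)$ and the set of minimal vectors $M(f)$ is the set of $v\in L\setminus\{0\}$ with $f(v)=m(f)$, taken modulo $\pm1$ (i.e. a set of representatives up to sign). *)

(* Defs.v *)
From HB Require Import structures.
From mathcomp Require Import all_boot all_order all_algebra all_field.
Set Implicit Arguments.
Unset Strict Implicit.
Unset Printing Implicit Defensive.
Import Order.TTheory GRing.Theory Num.Theory.
Local Open Scope ring_scope.

(* Number fields are modelled by [fieldExtType rat].  The image of an
   embedding of such a field into the complex numbers consists of algebraic
   numbers, so embeddings are ring morphisms into [algC]; an embedding is real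
   when all its values are. *)
Definition real_embedding (F : fieldExtType rat) (sigma : {rmorphism F -> algC})
  : Prop := forall x : F, sigma x \is Num.real.

Definition totally_real (F : fieldExtType rat) : Prop :=
  forall sigma : {rmorphism F -> algC}, real_embedding sigma.

Definition totally_positive (F : fieldExtType rat) (a : F) : Prop :=
  forall sigma : {rmorphism F -> algC}, real_embedding sigma -> 0 < sigma a.

(* Tr_{F/Q}(a): the trace of the Q-linear map x |-> a * x. *)
Definition field_trace (F : fieldExtType rat) (a : F) : rat :=
  \tr (passmx.mxof (vbasis {:F}) (vbasis {:F}) (amull a)).

Definition ring_of_integers (F : fieldExtType rat) (x : F) : Prop :=
  integralOver (intr : int -> F) x.

Definition integer_lattice (F : fieldExtType rat) (n : nat) (x : 'rV[F]_n)
  : Prop := forall i, ring_of_integers (x 0 i).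

Definition f_form (F : fieldExtType rat) (n : nat) (alpha : F) (x : 'rV[F]_n)
  : rat :=
  field_trace (alpha * \sum_(i < n) \sum_(j < n | (i <= j)%N) x 0 i * x 0 j).

Definition phi_form (F : fieldExtType rat) (alpha x : F) : rat :=
  field_trace (alpha * x ^+ 2).

(* [is_minimum L f m] reads m(f) = m, including that the minimum is attained. *)
Definition is_minimum (V : zmodType) (L : V -> Prop) (f : V -> rat) (m : rat)
  : Prop :=
  (exists v, [/\ L v, v != 0 & f v = m]) /\
  (forall v, L v -> v != 0 -> m <= f v).

Definition minimal_vector (V : zmodType) (L : V -> Prop) (f : V -> rat) (v : V)
  : Prop := [/\ L v, v != 0 & is_minimum L f (f v)].

(* [S] contains exactly one of [v] and [- v] for each minimal vector [v],
   and nothing else. *)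
Definition minimal_vectors_up_to_sign (V : zmodType) (L : V -> Prop)
    (f : V -> rat) (S : V -> Prop) : Prop :=
  [/\ forall v, S v -> minimal_vector L f v,
      forall v, minimal_vector L f v -> S v \/ S (- v)
    & forall v, S v -> ~ S (- v)].

Definition std_basis (F : fieldExtType rat) (n : nat) (i : 'I_n) : 'rV[F]_n :=
  delta_mx 0 i.

(* Main.v *)
(* Setting x_0 = - (x_1 + ... + x_n), the form satisfies
   2 f(x) = phi(x_0) + ... + phi(x_n).  The x_k sum to 0, so a nonzero x has at
   least two nonzero entries among them, each contributing at least m(phi);
   hence m(f) = m(phi), attained exactly when two entries are nonzero, opposite
   and minimal for phi.  Signs are normalised by one real embedding.

   Positivity of phi comes from Tr(a) = sum of the embeddings of a: over algC
   the commuting separable multiplication matrices of F are simultaneously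
   diagonalizable, and each diagonal entry is a ring morphism from F. *)
Require Import Defs.
From Stdlib Require Import Classical_Prop.
From HB Require Import structures.
From mathcomp Require Import all_boot all_order all_algebra all_field ring lra.
Set Implicit Arguments.
Unset Strict Implicit.
Unset Printing Implicit Defensive.
Import Order.TTheory GRing.Theory Num.Theory passmx.
Local Open Scope ring_scope.

(** * The trace as a sum of embeddings, and its integrality *)

Lemma rmorph_of_fun (F R : nzRingType) (f : F -> R) :
  (forall a b, f (a + b) = f a + f b) -> f 1 = 1 ->
  (forall a b, f (a * b) = f a * f b) ->
  exists sigma : {rmorphism F -> R}, sigma =1 f.
Proof.
move=> fD f1 fM.
have f_zmod : zmod_morphism f.
  have f0 : f 0 = 0 by apply: (addrI (f 0)); rewrite -fD !addr0.
  move=> a b; rewrite fD; congr (_ + _).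
  by apply: (addIr (f b)); rewrite -fD !addNr f0.
have f_mon : monoid_morphism f by split.
pose fa := GRing.isZmodMorphism.Build F R f f_zmod.
pose fm := GRing.isMonoidMorphism.Build F R f f_mon.
pose sigma : {rmorphism F -> R} := HB.pack f fa fm.
by exists sigma.
Qed.

(** In characteristic zero the minimal polynomial of [a] is separable, and its coefficients lie in
    the prime field. *)
Lemma minpoly_over_rat (F : fieldExtType rat) (a : F) :
  exists p : {poly rat}, separable_poly p /\ root (map_poly (in_alg F) p) a.
Proof.
have /polyOver1P[p Ep] := minPolyOver 1%AS a.
exists p; split; last by rewrite -Ep root_minPoly.
have F0 : [pchar F] =i pred0 by move=> q; rewrite pchar_lalg pchar_num.
have := pcharf0_separable 1%AS F0 a.
by rewrite /separable_element Ep separable_map.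
Qed.

(** A separable rational polynomial vanishing at [a] also annihilates [rho a]. Over [algC] it splits
    into distinct linear factors, so the minimal polynomial of [rho a] does too. *)
Lemma field_repr_diagonalizable (F : fieldExtType rat) (n : nat)
    (rho : F -> 'M[algC]_n) :
  (forall a b, rho (a + b) = rho a + rho b) -> rho 1 = 1%:M ->
  (forall a b, rho (a * b) = rho a *m rho b) ->
  (forall q a, rho (q *: a) = ratr q *: rho a) ->
  forall a, exists2 P, P \in unitmx & is_diag_mx (conjmx P (rho a)).
Proof.
(* Size zero is set apart: the matrix ring is trivial there, and diagonality is vacuous. *)
case: n rho => [|n] rho rhoD rho1 rhoM rhoZ a.
  by exists 1%:M; rewrite ?unitmx1 //; apply/is_diag_mxP => -[].
have [p [sep_p root_p]] := minpoly_over_rat a.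
apply/diagonalizableP.
pose pC := map_poly (ratr : rat -> algC) p.
have hornerE q : horner_mx (rho a) (map_poly ratr q) = rho (map_poly (in_alg F) q).[a].
  elim/poly_ind: q => [|q c IHq].
    rewrite !rmorph0 horner0.
    by apply: (addrI (rho 0)); rewrite -rhoD !addr0.
  rewrite !rmorphD !rmorphM /= !map_polyX !map_polyC /= horner_mx_C horner_mx_X.
  by rewrite hornerMXaddC IHq rhoD rhoM rhoZ rho1 scalemx1.
have [rs Ers] := closed_field_poly_normal pC.
have nz_p : p != 0 by apply: separable_poly_neq0.
have nz_lc : lead_coef pC != 0 by rewrite lead_coef_eq0 map_poly_eq0.
exists rs.
  rewrite -separable_prod_XsubC.
  rewrite (eqp_separable (q := pC)) ?separable_map //.
  by rewrite eqp_sym Ers eqp_scale.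
have : mxminpoly (rho a) %| pC.
  apply: mxminpoly_min; rewrite hornerE (rootP root_p).
  by apply: (addrI (rho 0)); rewrite -rhoD !addr0.
by rewrite Ers dvdpZr.
Qed.

Lemma field_repr_trace (F : fieldExtType rat) (n : nat)
    (rho : F -> 'M[algC]_n) :
  (forall a b, rho (a + b) = rho a + rho b) -> rho 1 = 1%:M ->
  (forall a b, rho (a * b) = rho a *m rho b) ->
  (forall q a, rho (q *: a) = ratr q *: rho a) ->
  exists sigma : 'I_n -> {rmorphism F -> algC},
    forall a, \tr (rho a) = \sum_i sigma i a.
Proof.
move=> rhoD rho1 rhoM rhoZ.
(* Simultaneous diagonalization applies to a finite list. The images of a basis suffice: by
   linearity the same [P] diagonalizes every [rho a], which is [D_diag] below. *)
pose As := [seq rho b | b <- vbasis {:F}].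
have [|P uP /allP diagP] := (codiagonalizableP As).1.
  split; last by move=> _ /mapP[b _ ->]; apply: field_repr_diagonalizable.
  by move=> _ _ /mapP[b _ ->] /mapP[c _ ->]; rewrite /comm_mx -!rhoM mulrC.
pose D a := P *m rho a *m invmx P.
have DD a b : D (a + b) = D a + D b by rewrite /D rhoD mulmxDr mulmxDl.
have D1 : D 1 = 1%:M by rewrite /D rho1 mulmx1 mulmxV.
have DM a b : D (a * b) = D a *m D b.
  by rewrite /D rhoM !mulmxA mulmxKV.
have DZ q a : D (q *: a) = ratr q *: D a.
  by rewrite /D rhoZ -scalemxAr -scalemxAl.
have D_diag a i j : i != j -> D a i j = 0.
  move=> neq_ij; rewrite (coord_vbasis (memvf a)).
  elim/big_rec: _ => [|k b _ IHb].
    have : D 0 + 0 = D 0 + D 0 by rewrite -DD !addr0.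
    by move/addrI <-; rewrite mxE.
  rewrite DD mxE IHb addr0 DZ mxE.
  have mem_k : rho (vbasis {:F})`_k \in As.
    by apply: map_f; rewrite mem_nth // size_tuple.
  have /= := diagP _ mem_k; rewrite /similar_to conjumx // => /is_diag_mxP.
  by move/(_ i j neq_ij); rewrite -/(D _) => ->; rewrite mulr0.
have sigP (i : 'I_n) : exists sigma : {rmorphism F -> algC}, sigma =1 fun a => D a i i.
  apply: rmorph_of_fun => [a b||a b].
  - by rewrite DD [LHS]mxE.
  - by rewrite D1 mxE eqxx.
  rewrite DM [LHS]mxE (bigD1 i) //= big1 ?addr0 // => j neq_ji.
  by rewrite D_diag ?mul0r // eq_sym.
have [sigma sigmaE] := fin_all_exists sigP.
exists sigma => a; under eq_bigr do rewrite sigmaE.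
by rewrite -[RHS]/(\tr (D a)) mxtrace_mulC mulKmx.
Qed.

(** The regular representation, extended to [algC], supplies [rho]. The bound [0 < d] provides an
    actual embedding, used for strict positivity and later to choose signs. *)
Lemma field_trace_sum_embeddings (F : fieldExtType rat) :
  exists (d : nat) (sigma : 'I_d -> {rmorphism F -> algC}),
    (0 < d)%N /\ forall a, ratr (field_trace a) = \sum_i sigma i a.
Proof.
pose e := vbasis {:F}; have e_basis : basis_of {:F} e by apply: vbasisP.
pose rho a := map_mx (ratr : rat -> algC) (mxof e e (amull a)).
have [||||sigma sigmaE] := @field_repr_trace F _ rho.
- by move=> a b; rewrite /rho !linearD map_mxD.
- by rewrite /rho amull1 mxof1 ?(basis_free e_basis) // map_mx1.
- move=> a b; rewrite /rho mulrC amullM -map_mxM.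
  by rewrite (mxof_comp _ _ e_basis).
- by move=> q a; rewrite /rho !linearZ /= map_mxZ.
exists (\dim {:F}), sigma; split=> [|a]; first exact: adim_gt0.
by rewrite -sigmaE /rho /field_trace trace_map_mx.
Qed.

Lemma field_trace_is_scalar (F : fieldExtType rat) : scalar (@field_trace F).
Proof. by move=> q a b; rewrite /field_trace !linearP. Qed.

HB.instance Definition _ (F : fieldExtType rat) :=
  GRing.isSemilinear.Build rat F rat *%R (@field_trace F)
    (GRing.semilinear_linear (@field_trace_is_scalar F)).

(** Every embedding sends [x] to a root of the same monic integer polynomial, so the trace is an
    algebraic integer; being rational, it is an integer. *)
Lemma field_trace_int (F : fieldExtType rat) (x : F) :
  ring_of_integers x -> field_trace x \is a Num.int.
Proof.
move=> [p mon_p root_p]; have [d [sigma [_ sigmaE]]] := field_trace_sum_embeddings F.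
rewrite -Cint_rat; apply: Cint_rat_Aint; first exact: Crat_rat.
rewrite sigmaE; apply: rpred_sum => i _.
apply: (@root_monic_Aint (map_poly intr p)).
- have /= := rmorph_root (sigma i) root_p; rewrite -map_poly_comp.
  by congr root; apply: eq_map_poly => z /=; rewrite rmorph_int.
- exact: monic_map.
by apply/polyOverP => i'; rewrite coef_map /= intr_int.
Qed.

(** * Positive definiteness of [phi_form] *)

Section TotallyReal.
Variables (F : fieldExtType rat) (F_real : totally_real F).
Variables (alpha : F) (alpha_pos : totally_positive alpha).
Implicit Types x y : F.

Lemma phi_form_gt0 x : x != 0 -> 0 < phi_form alpha x.
Proof.
move=> nz_x; have [d [sigma [d_gt0 sigmaE]]] := field_trace_sum_embeddings F.
have pos i : 0 < sigma i (alpha * x ^+ 2).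
  rewrite rmorphM rmorphXn /= mulr_gt0 ?alpha_pos //.
  by rewrite real_exprn_even_gt0 ?F_real //= fmorph_eq0.
rewrite -(ltr_rat algC) rmorph0 sigmaE; case: d => // d in sigma d_gt0 sigmaE pos *.
rewrite big_ord_recl ltr_wpDr ?pos // sumr_ge0 // => i _.
exact: ltW.
Qed.

Lemma phi_form0 : phi_form alpha 0 = 0.
Proof. by rewrite /phi_form expr0n mulr0 raddf0. Qed.

Lemma phi_form_ge0 x : 0 <= phi_form alpha x.
Proof.
by have [->|/phi_form_gt0/ltW//] := eqVneq x 0; rewrite phi_form0.
Qed.

Lemma phi_form_eq0 x : (phi_form alpha x == 0) = (x == 0).
Proof.
have [->|/phi_form_gt0/lt0r_neq0/negbTE//] := eqVneq x 0.
by rewrite phi_form0 eqxx.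
Qed.

Lemma phi_formN x : phi_form alpha (- x) = phi_form alpha x.
Proof. by rewrite /phi_form sqrrN. Qed.

Lemma phi_formD x y :
  phi_form alpha (x + y) =
  phi_form alpha x + phi_form alpha y + field_trace (alpha * x * y) *+ 2.
Proof.
rewrite /phi_form -raddfMn -!raddfD /=; congr field_trace; ring.
Qed.

(** Nonnegativity of [phi_form] at [x + y] and at [x - y] bounds the pairing from both sides. *)
Lemma trace_pairing_bound x y :
  `|field_trace (alpha * x * y)| *+ 2 <= phi_form alpha x + phi_form alpha y.
Proof.
have := phi_form_ge0 (x + y); have := phi_form_ge0 (x - y).
rewrite !phi_formD phi_formN mulrN raddfN /= => ? ?.
by rewrite -normrMn ler_norml; apply/andP; split; lra.
Qed.

End TotallyReal.

(** * Algebraic integers, and the minimum of [phi_form] *)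

Lemma intr_fieldext_eq0 (F : fieldExtType rat) (z : int) :
  (z%:~R == 0 :> F) = (z == 0).
Proof. by rewrite -(rmorph_int (in_alg F)) fmorph_eq0 intr_eq0. Qed.

(** The multiplier is the leading coefficient of an integer polynomial with root [y]: after scaling,
    the product is a root of a monic one. *)
Lemma integer_multiple (F : fieldExtType rat) (y : F) :
  exists2 a : int, a != 0 & ring_of_integers (a%:~R * y).
Proof.
have [p0 [/separable_poly_neq0 nz_p0 root_p0]] := minpoly_over_rat y.
have [p [c nz_c Dp]] := rat_poly_scale p0.
have nz_p : p != 0 by apply: contraNneq nz_p0 => p_0; rewrite Dp p_0 rmorph0 scaler0.
have root_p : root (map_poly (intr : int -> F) p) y.
  move: root_p0; rewrite Dp linearZ /= rootZ ?scaler_eq0 ?invr_eq0.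
    rewrite -map_poly_comp; congr root; apply: eq_map_poly => z /=.
    by rewrite -[LHS]/(in_alg F _) rmorph_int.
  by rewrite intr_eq0 oner_eq0 orbF.
set a := lead_coef p; exists a; first by rewrite lead_coef_eq0.
(* A nonzero polynomial with a root is not constant. *)
have [n size_p] : exists n, size p = n.+2.
  case E: (size p) => [|[|n]]; last by exists n.
    by move/eqP: E; rewrite size_poly_eq0 (negbTE nz_p).
  have /size_poly1P[z nz_z Ez] : size p == 1%N by rewrite E.
  by move: root_p; rewrite Ez map_polyC rootC /= intr_fieldext_eq0 (negbTE nz_z).
(* [q(a X) = a ^ n * p(X)] for [p] of degree [n + 1] *)
pose q := 'X^(n.+1) + \poly_(i < n.+1) (p`_i * a ^+ (n - i)).
exists q.
  rewrite monicE lead_coefDl ?lead_coefXn // size_polyXn ltnS.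
  exact: size_poly.
have : a%:~R ^+ n * (map_poly (intr : int -> F) p).[y] = 0.
  by rewrite (rootP root_p) mulr0.
rewrite horner_coef size_map_poly_id0; last by rewrite intr_fieldext_eq0 lead_coef_eq0.
rewrite size_p big_ord_recr /= mulrDr coef_map /= -[n.+1]/(n.+2.-1) -size_p -lead_coefE.
rewrite -/a mulr_sumr size_p /= => E; apply/rootP.
rewrite rmorphD /= map_polyXn hornerD hornerXn -[RHS]E addrC; congr (_ + _); last first.
  by rewrite exprMn mulrA -exprSr.
(* The lower coefficients may vanish, so only an upper bound on the size of this part is
   available. *)
rewrite (@horner_coef_wide _ n.+1); last first.
  by apply: leq_trans (size_poly _ _) _; apply: size_poly.
apply: eq_bigr => i _; rewrite !coef_map coef_poly ltn_ord /= exprMn.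
have le_in : (i <= n)%N by rewrite -ltnS.
have -> : (a%:~R : F) ^+ n = a%:~R ^+ (n - i) * a%:~R ^+ i by rewrite -exprD subnK.
by rewrite rmorphM rmorphXn /=; ring.
Qed.

(** Since [P] is an arbitrary proposition, the list is built by induction on the values in [T], with
    excluded middle deciding whether each value is attained on [P]. *)
Lemma finite_injective_image (X : eqType) (T : finType) (P : X -> Prop)
    (g : X -> T) :
  (forall x y, P x -> P y -> g x = g y -> x = y) ->
  exists s : seq X, forall x, x \in s <-> P x.
Proof.
move=> g_inj.
suff [s sP] : exists s : seq X, forall x, x \in s <-> (P x /\ g x \in enum T).
  by exists s => x; rewrite sP mem_enum; split=> [[]|].
elim: (enum T) => [|t ts [s IHs]]; first by exists [::] => x; split=> [|[]].
have [[x [Px gx]]|noP] := classic (exists x, P x /\ g x = t).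
  exists (x :: s) => y; rewrite !inE; split.
    by case/predU1P=> [->|/IHs[Py ->]]; rewrite ?gx ?eqxx ?orbT.
  case=> Py /predU1P[gy|g_y]; apply/predU1P; last by right; apply/IHs.
  by left; apply: g_inj; rewrite // gy.
exists s => y; rewrite IHs inE; split=> [[Py ->]|]; first by rewrite orbT.
by case=> Py /predU1P[gy|//]; case: noP; exists y.
Qed.

Lemma ring_of_integers1 (F : fieldExtType rat) : @ring_of_integers F 1.
Proof. exact: integral1. Qed.

Lemma ring_of_integersN (F : fieldExtType rat) (x : F) :
  ring_of_integers x -> ring_of_integers (- x).
Proof. exact: integral_opp. Qed.

Lemma ring_of_integers_sum (F : fieldExtType rat) (I : finType) (x : I -> F) :
  (forall i, ring_of_integers (x i)) -> ring_of_integers (\sum_i x i).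
Proof.
move=> Ox; apply: (big_ind (@ring_of_integers F)) => //; first exact: integral0.
by move=> a b; apply: integral_add.
Qed.

Section MinimumOfPhi.
Variables (F : fieldExtType rat) (F_real : totally_real F).
Variables (alpha : F) (alpha_pos : totally_positive alpha).
Implicit Types x y : F.

(* An integer [x] is determined by the rational integers
   [Tr (alpha * x * y j)], which are bounded in terms of [phi x]. *)
Lemma finite_integers_phi_le (C : rat) :
  exists s : seq F, forall x,
    x \in s <-> (ring_of_integers x /\ phi_form alpha x <= C).
Proof.
pose b := vbasis {:F}.
(* The [a j] clear the denominators of [alpha * b_j], which makes the traces [t x j] rational
   integers for integral [x]. *)
have [a aP] := fin_all_exists (fun j : 'I_(\dim {:F}) =>
  let: ex_intro2 a nz_a Oa := integer_multiple (alpha * b`_j) in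
  ex_intro (fun a : int => a != 0 /\ ring_of_integers (a%:~R * (alpha * b`_j)))
    a (conj nz_a Oa)).
pose y j := (a j)%:~R * b`_j.
pose t x j := field_trace (alpha * x * y j).
have t_int x j : ring_of_integers x -> t x j \is a Num.int.
  move=> Ox; apply: field_trace_int.
  have -> : alpha * x * y j = x * ((a j)%:~R * (alpha * b`_j)) by rewrite /y; ring.
  exact: integral_mul Ox (aP j).2.
pose B := (\max_j Num.bound (C + phi_form alpha (y j)))%N.
have t_bound x j : phi_form alpha x <= C -> `|t x j| <= B%:R.
  move=> le_xC; have := trace_pairing_bound F_real alpha_pos x (y j).
  rewrite -/(t x j) => le_t; have t_ge0 := normr_ge0 (t x j).
  have C_ge0 : 0 <= C + phi_form alpha (y j) by lra.
  have : (Num.bound (C + phi_form alpha (y j)))%:R <= B%:R :> rat.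
    by rewrite ler_nat /B (leq_bigmax j).
  have := archi_boundP C_ge0; lra.
have t_trunc x j : ring_of_integers x -> phi_form alpha x <= C ->
    (Num.truncn (t x j + B%:R))%:R = t x j + B%:R.
  move=> Ox le_xC; apply: truncnK; rewrite natrEint rpredD ?t_int ?intr_nat //=.
  by have := t_bound x j le_xC; rewrite ler_norml => /andP[]; lra.
(* Shifting by [B] moves the integers [t x j] from [[-B, B]] to [[0, 2B]], so that they fit in a
   finite ordinal type. *)
pose g x := [ffun j => inord (Num.truncn (t x j + B%:R)) : 'I_(B + B).+1].
apply: (finite_injective_image (g := g)) => x z [Ox le_xC] [Oz le_zC] eq_g.
have eq_t j : t x j = t z j.
  apply: (addIr B%:R); rewrite -(t_trunc x) // -(t_trunc z) //; congr _%:R.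
  have lt_B w : ring_of_integers w -> phi_form alpha w <= C ->
      (Num.truncn (t w j + B%:R) < (B + B).+1)%N.
    move=> Ow le_wC; rewrite ltnS -(ler_nat rat) t_trunc // natrD lerD2r.
    by apply: le_trans (t_bound w j le_wC); apply: ler_norm.
  have := congr1 (fun h : {ffun _} => nat_of_ord (h j)) eq_g.
  by rewrite !ffunE !inordK ?lt_B.
(* Nondegeneracy of the trace pairing: expanding one factor of [(x - z) ^+ 2] in the basis writes
   [phi_form alpha (x - z)] as a combination of traces that all vanish. *)
apply/eqP; rewrite -subr_eq0 -(phi_form_eq0 F_real alpha_pos) /phi_form expr2 mulrA.
rewrite {2}(coord_vbasis (memvf (x - z))) mulr_sumr raddf_sum big1 //= => j _.
rewrite -scalerAr linearZ /=.
suff -> : field_trace (alpha * (x - z) * b`_j) = 0 by rewrite mulr0.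
have nz_a : (a j)%:~R != 0 :> rat by rewrite intr_eq0 (aP j).1.
apply: (mulfI nz_a); rewrite mulr0.
have <- w : field_trace ((a j)%:~R *: w) = (a j)%:~R * field_trace w by rewrite linearZ.
have -> : (a j)%:~R *: (alpha * (x - z) * b`_j) = alpha * x * y j - alpha * z * y j.
  by rewrite -mulr_algl -[_%:A]/(in_alg F _) rmorph_int /y; ring.
by rewrite raddfB /= -/(t x j) eq_t subrr.
Qed.

(** The value at the integer [1] is a cut-off: the minimum is sought among the finitely many nonzero
    integers not exceeding it, and all vectors attaining it are collected in [s]. *)
Lemma phi_form_minimum :
  exists (m : rat) (s : seq F), is_minimum (@ring_of_integers F) (phi_form alpha) m /\
    forall x, x \in s <-> [/\ ring_of_integers x, x != 0 & phi_form alpha x = m].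
Proof.
have [s sP] := finite_integers_phi_le (phi_form alpha 1).
pose s1 := [seq x <- s | x != 0].
have s1_1 : 1 \in s1.
  by rewrite mem_filter oner_neq0; apply/sP; split=> //; apply: ring_of_integers1.
pose x0 : seq_sub s1 := SeqSub s1_1.
have [x1 min1] : exists x1 : seq_sub s1, forall x : seq_sub s1,
    phi_form alpha (val x1) <= phi_form alpha (val x).
  have := arg_minP (fun x : seq_sub s1 => phi_form alpha (val x))
    (erefl true : xpredT x0).
  by case=> x1 _ min1; exists x1 => x; apply: min1.
case: x1 => x1 /= s1x1 in min1.
exists (phi_form alpha x1), [seq x <- s1 | phi_form alpha x == phi_form alpha x1].
have := s1x1; rewrite mem_filter => /andP[nz_x1 /sP[Ox1 le_x1]].
split.
  split=> [|x Ox nz_x]; first by exists x1.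
  have [le_x|/ltW] := lerP (phi_form alpha x) (phi_form alpha 1); last exact: le_trans.
  have s1x : x \in s1 by rewrite mem_filter nz_x; apply/sP.
  exact: (min1 (SeqSub s1x)).
move=> x; rewrite !mem_filter; split.
  by case/and3P=> /eqP phi_x nz_x /sP[Ox _].
by case=> Ox nz_x phi_x; rewrite phi_x eqxx nz_x; apply/sP; rewrite phi_x.
Qed.

End MinimumOfPhi.

(** * The doubled form and its values on root multiples *)

Lemma sum_upper_triangle (R : comNzRingType) (n : nat) (x : 'I_n -> R) :
  (\sum_(i < n) \sum_(j < n | (i <= j)%N) x i * x j) *+ 2 =
  \sum_i x i ^+ 2 + (\sum_i x i) ^+ 2.
Proof.
set T := \sum_(i < n) _.
have T_lower : T = \sum_(i < n) \sum_(j < n | (j <= i)%N) x i * x j.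
  rewrite /T (exchange_big_dep xpredT) //=; apply: eq_bigr => j _.
  by apply: eq_bigr => i _; rewrite mulrC.
rewrite mulr2n {2}T_lower -big_split expr2 mulr_suml -big_split /=.
apply: eq_bigr => i _; rewrite mulr_sumr big_mkcond [X in _ + X]big_mkcond.
rewrite -big_split (bigD1 i) // [in RHS](bigD1 i) //= leqnn expr2 addrA; congr (_ + _).
by apply: eq_bigr => j; rewrite -val_eqE /=; case: ltngtP; rewrite ?addr0 ?add0r.
Qed.

(** The last term is the contribution of [x_0], whose sign is immaterial because [phi_form] is
    even. *)
Lemma f_form_double (F : fieldExtType rat) (n : nat) (alpha : F) (x : 'rV[F]_n) :
  f_form alpha x *+ 2 =
  \sum_i phi_form alpha (x 0 i) + phi_form alpha (\sum_i x 0 i).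
Proof.
rewrite /f_form /phi_form -raddf_sum -raddfMn -raddfD /= -mulrnAr.
by rewrite sum_upper_triangle mulrDr mulr_sumr.
Qed.

(** In the coordinates [x_0, ..., x_n] of sum zero, these are [eta] times the roots of type [A_n],
    one from each opposite pair; [e_i] is the root involving [x_0]. *)
Definition root_multiple (F : fieldExtType rat) (n : nat) (eta : F) (v : 'rV[F]_n) :=
  (exists i : 'I_n, v = eta *: std_basis F i) \/
  (exists i j : 'I_n, (i < j)%N /\ v = eta *: (std_basis F i - std_basis F j)).

(** The order [i < j] puts [eta], and not its opposite, first. This recovers [eta] from [v] and
    later separates [v] from [- v]. *)
Lemma root_multiple_leading (F : fieldExtType rat) (n : nat) (eta : F) (v : 'rV[F]_n) :
  root_multiple eta v ->
  exists i : 'I_n, v 0 i = eta /\ forall k : 'I_n, (k < i)%N -> v 0 k = 0.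
Proof.
case=> [[i ->]|[i [j [lt_ij ->]]]]; exists i; rewrite !mxE !eqxx /=.
  rewrite mulr1; split=> // k lt_ki.
  by rewrite !mxE eqxx -val_eqE (ltn_eqF lt_ki) mulr0.
split=> [|k lt_ki]; first by rewrite -val_eqE (ltn_eqF lt_ij) subr0 mulr1.
rewrite !mxE eqxx -!val_eqE (ltn_eqF lt_ki) (ltn_eqF (ltn_trans lt_ki lt_ij)).
by rewrite subr0 mulr0.
Qed.

Lemma root_multiple_integer (F : fieldExtType rat) (n : nat) (eta : F) (v : 'rV[F]_n) :
  ring_of_integers eta -> root_multiple eta v -> integer_lattice v.
Proof.
move=> Oeta vP k.
have Ob (b : bool) : @ring_of_integers F b%:R by apply: integral_nat.
case: vP => [[i ->]|[i [j [_ ->]]]]; rewrite !mxE eqxx.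
  exact: integral_mul Oeta (Ob _).
exact: integral_mul Oeta (integral_sub (Ob _) (Ob _)).
Qed.

(** In the doubled identity exactly two of [x_0, ..., x_n] can be nonzero, equal to [eta] and
    [- eta]. *)
Lemma f_form_root_multiple (F : fieldExtType rat) (n : nat) (alpha eta : F)
    (v : 'rV[F]_n) :
  root_multiple eta v -> f_form alpha v = phi_form alpha eta.
Proof.
move=> vP; apply: (mulIf (_ : 2%:R != 0)) => //.
rewrite !mulr_natr f_form_double mulr2n.
case: vP => [[i ->]|[i [j [lt_ij ->]]]].
  have zero k : k != i -> (eta *: std_basis F i) 0 k = 0.
    by move=> /negbTE neq_ki; rewrite !mxE neq_ki mulr0.
  rewrite [X in phi_form _ X](_ : _ = eta); last first.
    by rewrite (bigD1 i) //= big1 // !mxE !eqxx mulr1 addr0.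
  rewrite (bigD1 i) //= big1 => [|k ki]; last by rewrite zero ?phi_form0.
  by rewrite !mxE !eqxx mulr1 addr0.
have neq_ji : (j == i) = false by rewrite -val_eqE gtn_eqF.
set u := _ *: _.
have ui : u 0 i = eta by rewrite !mxE !eqxx eq_sym neq_ji subr0 mulr1.
have uj : u 0 j = - eta by rewrite !mxE !eqxx neq_ji sub0r mulrN1.
have u0 k : (k != i) && (k != j) -> u 0 k = 0.
  by case/andP=> /negbTE ki /negbTE kj; rewrite !mxE ki kj subr0 mulr0.
rewrite [X in phi_form _ X](_ : _ = 0); last first.
  rewrite (bigD1 i) //= (bigD1 j) ?neq_ji //= big1 => [|k /u0//].
  by rewrite ui uj addr0 subrr.
rewrite phi_form0 addr0 (bigD1 i) //= (bigD1 j) ?neq_ji //= ui uj phi_formN.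
by rewrite big1 ?addr0 // => k /u0 ->; rewrite phi_form0.
Qed.

(** * Lower bound for [f_form] and the case of equality *)

Section MinimumOfF.
Variables (F : fieldExtType rat) (F_real : totally_real F).
Variables (alpha : F) (alpha_pos : totally_positive alpha).
Variable m : rat.
Hypothesis phi_ge : forall y, ring_of_integers y -> y != 0 -> m <= phi_form alpha y.
Variables (n : nat) (x : 'rV[F]_n).
Hypotheses (Ox : integer_lattice x) (nz_x : x != 0).

Let phi_ge0 := phi_form_ge0 F_real alpha_pos.

Let vanish (P : pred 'I_n) : \sum_(k | P k) phi_form alpha (x 0 k) <= 0 ->
  forall k, P k -> x 0 k = 0.
Proof.
move=> le0 k Pk; apply/eqP; rewrite -(phi_form_eq0 F_real alpha_pos).
have /psumr_eq0P-> // : \sum_(k | P k) phi_form alpha (x 0 k) = 0.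
by apply: le_anti; rewrite le0 sumr_ge0.
Qed.

Lemma f_form_lower_bound :
  m <= f_form alpha x /\
  (f_form alpha x = m -> exists eta, [/\ ring_of_integers eta, eta != 0,
     phi_form alpha eta = m & root_multiple eta x]).
Proof.
have [i nz_xi] : exists i, x 0 i != 0 by apply/rV0Pn.
have x_rowE : x = \sum_k x 0 k *: std_basis F k by apply: row_sum_delta.
have dbl := f_form_double alpha x; set S := \sum_i x 0 i in dbl.
rewrite (bigD1 i) //= in dbl.
have phi_i := phi_ge (Ox i) nz_xi.
(* Here [S] is [- x_0]. If it is nonzero, [x_i] and [x_0] are the two nonzero entries; otherwise a
   second nonzero coordinate [x_j] must cancel [x_i]. Equality leaves no room for further
   entries. *)
have [S0|nz_S] := eqVneq S 0; last first.
  have phi_S := phi_ge (ring_of_integers_sum Ox) nz_S.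
  have rest_ge0 : 0 <= \sum_(k | k != i) phi_form alpha (x 0 k) by rewrite sumr_ge0.
  split=> [|f_x]; first by lra.
  exists (x 0 i); split=> //; first by lra.
  left; exists i; rewrite {1}x_rowE (bigD1 i) //= big1 ?addr0 // => k ki.
  by rewrite (vanish (P := predC1 i)) ?scale0r //=; lra.
have [j ji nz_xj] : exists2 j, j != i & x 0 j != 0.
  apply/exists_inP; apply: contraNT nz_xi; rewrite negb_exists_in => /forall_inP x0.
  rewrite -S0 /S (bigD1 i) //= big1 ?addr0 // => k ki.
  by apply/eqP; have := x0 k ki; rewrite negbK.
have phi_j := phi_ge (Ox j) nz_xj.
rewrite (bigD1 j) //= S0 phi_form0 addr0 in dbl.
have rest_ge0 : 0 <= \sum_(k | (k != i) && (k != j)) phi_form alpha (x 0 k).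
  by rewrite sumr_ge0.
split=> [|f_x]; first by lra.
have x0 k : (k != i) && (k != j) -> x 0 k = 0.
  by apply: (vanish (P := fun k => (k != i) && (k != j))); lra.
have xE : x = x 0 i *: std_basis F i + x 0 j *: std_basis F j.
  rewrite {1}x_rowE (bigD1 i) //= (bigD1 j) //= big1 ?addr0 // => k kij.
  by rewrite x0 ?scale0r.
have xj : x 0 j = - x 0 i.
  apply/eqP; rewrite -addr_eq0 addrC -S0 /S (bigD1 i) //= (bigD1 j) //=.
  by rewrite [X in _ == _ + (_ + X)]big1 ?addr0.
(* The entry of smaller index serves as [eta], to match the ordering in [root_multiple]. *)
have [lt_ij|lt_ji|/val_inj eq_ij] := ltngtP i j; last by rewrite eq_ij eqxx in ji.
  exists (x 0 i); split=> //; first by lra.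
  by right; exists i, j; split=> //; rewrite {1}xE xj scaleNr scalerBr.
exists (x 0 j); split=> //; first by lra.
by right; exists j, i; split=> //; rewrite {1}xE xj !scaleNr scalerBr opprB.
Qed.

End MinimumOfF.

Theorem theorem3p5 (F : fieldExtType rat) (F_real : totally_real F)
    (n : nat) (n_ge1 : (1 <= n)%N)
    (alpha : F) (alpha_pos : totally_positive alpha) :
  exists (r : nat) (eta : 'I_r -> F),
    [/\ forall k, ring_of_integers (eta k) /\ eta k != 0,
        exists m : rat,
          [/\ is_minimum (@integer_lattice F n) (f_form alpha) m,
              is_minimum (@ring_of_integers F) (phi_form alpha) m
            & forall k, m = field_trace (alpha * eta k ^+ 2)]
      & minimal_vectors_up_to_sign (@integer_lattice F n) (f_form alpha)
          (fun v : 'rV[F]_n => exists k : 'I_r,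
             (exists i : 'I_n, v = eta k *: std_basis F i) \/
             (exists i j : 'I_n, (i < j)%N /\
                v = eta k *: (std_basis F i - std_basis F j)))].
Proof.
have [m [s [min_m sP]]] := phi_form_minimum F_real alpha_pos.
have [d [sigmas [d_gt0 _]]] := field_trace_sum_embeddings F.
pose sigma := sigmas (Ordinal d_gt0).
(* The minimal vectors of [phi_form] come in pairs [y], [- y]; the sign under the fixed embedding
   [sigma] selects one of each. *)
pose pos_s := [seq y <- s | 0 < sigma y].
pose eta (k : 'I_(size pos_s)) := pos_s`_k.
have etaP k : [/\ ring_of_integers (eta k), eta k != 0, phi_form alpha (eta k) = m
    & 0 < sigma (eta k)].
  have : eta k \in pos_s by apply: mem_nth.
  by rewrite mem_filter => /andP[? /sP[]].
have f_lower := f_form_lower_bound F_real alpha_pos min_m.2.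
have root_minimal y v : ring_of_integers y -> y != 0 -> phi_form alpha y = m ->
    root_multiple y v -> [/\ @integer_lattice F n v, v != 0 & f_form alpha v = m].
  move=> Oy nz_y phi_y vP; split; first exact: root_multiple_integer vP.
    have [i [vi _]] := root_multiple_leading vP.
    by apply: contraNneq nz_y => v0; rewrite -vi v0 mxE.
  by rewrite (f_form_root_multiple _ vP).
have min_f : is_minimum (@integer_lattice F n) (f_form alpha) m.
  split; last by move=> v Ov /(f_lower _ v Ov)[].
  have [[y [Oy nz_y phi_y]] _] := min_m.
  exists (y *: std_basis F (Ordinal n_ge1)).
  by apply: (root_minimal y) => //; left; exists (Ordinal n_ge1).
exists (size pos_s), eta; split.
- by move=> k; have [] := etaP k.
- by exists m; split=> // k; have [_ _ <-] := etaP k.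
split=> [v [k vP]|v [Ov nz_v [[w [Ow nz_w fw]] min_v]]|v [k vP] [l NvP]].
- have [Oeta nz_eta phi_eta _] := etaP k.
  have [Ov nz_v fv] := root_minimal _ _ Oeta nz_eta phi_eta vP.
  by split; rewrite // fv.
- have fv : f_form alpha v = m.
    have [[u [Ou nz_u fu]] min_f2] := min_f.
    by apply: le_anti; rewrite -{1}fu min_v //= min_f2.
  have [y [Oy nz_y phi_y vP]] := (f_lower _ v Ov nz_v).2 fv.
  have in_eta z : ring_of_integers z -> z != 0 -> phi_form alpha z = m ->
      0 < sigma z -> exists k, eta k = z.
    move=> Oz nz_z phi_z pos_z.
    have z_in : z \in pos_s by rewrite mem_filter pos_z; apply/sP.
    have lt_z : (index z pos_s < size pos_s)%N by rewrite index_mem.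
    by exists (Ordinal lt_z); apply: nth_index.
  have : sigma y != 0 by rewrite fmorph_eq0.
  rewrite real_neqr_lt ?real0 ?F_real // => /orP[neg_y|pos_y]; last first.
    by left; have [k etak] := in_eta y Oy nz_y phi_y pos_y; exists k; rewrite etak.
  right; have [|||| k etak] := in_eta (- y).
  + exact: ring_of_integersN.
  + by rewrite oppr_eq0.
  + by rewrite phi_formN.
  + by rewrite rmorphN oppr_gt0.
  exists k; rewrite etak; case: vP => [[i ->]|[i [j [lt_ij ->]]]].
    by left; exists i; rewrite scaleNr.
  by right; exists i, j; rewrite scaleNr.
(* If [v] and [- v] were both listed, their leading entries would sit at the same index, giving
   [eta l = - eta k], although both are positive under [sigma]. *)
have [_ nz_k _ pos_k] := etaP k; have [_ nz_l _ pos_l] := etaP l.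
have [i [vi v_lt]] := root_multiple_leading vP.
have [i' [vi' v_lt']] := root_multiple_leading NvP.
rewrite mxE in vi'.
have [lt_i|lt_i|/val_inj eq_i] := ltngtP i i'.
- by have := v_lt' i lt_i; rewrite mxE vi => /eqP; rewrite oppr_eq0 (negbTE nz_k).
- by move: nz_l; rewrite -vi' v_lt // oppr0 eqxx.
by move: pos_l; rewrite -vi' -eq_i vi rmorphN oppr_gt0 lt_gtF.
Qed.
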